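(* Let $\gamma(t)=(x(t),y(t),z(t))\in H^1$ be a horizontally regular curve, not necessarily parametrized by horizontal arc-length. Then its $p$-curvature $k(t)$ and $T$-variation $\tau(t)$ are given by $$k(t)=\frac{x'y''-x''y'}{\big((x')^2+(y')^2\big)^{3/2}}(t),\qquad \tau(t)=\frac{xy'-x'y+z'}{\big((x')^2+(y')^2\big)^{1/2}}(t).$$
   Context: $H^1$ is $\mathbb{R}^3$ with group law $(x_1,y_1,z_1)\circ(x_2,y_2,z_2)=(x_1+x_2,\,y_1+y_2,\,z_1+z_2+y_1x_2-x_1y_2)$ and left invariant vector fields $\mathring e_1=\partial_x+y\,\partial_z$, $\mathring e_2=\partial_y-x\,\partial_z$, $T=\partial_z$. The contact bundle is $\xi_0=\mathrm{span}(\mathring e_1,\mathring e_2)$, and $J_0:\xi_0\to\xi_0$ is given by $J_0\mathring e_1=\mathring e_2$, $J_0\mathring e_2=-\mathring e_1$. $\langle\cdot,\cdot\rangle$ is the Riemannian metric on $H^1$ for which $\mathring e_1,\mathring e_2,T$ are orthonormal, and $|\cdot|$ its norm. All curves are smooth. For a parametrized curve $\gamma$, write $\gamma'=\gamma'_{\xi_0}+\gamma'_T$ with $\gamma'_{\xi_0}\in\xi_0$ and $\gamma'_T$ a multiple of $T$. The curve is horizontally regular if $\gamma'_{\xi_0}(t)\neq0$ for every $t$. The horizontal arc-length is $s(t)=\int_{t_0}^t|\gamma'_{\xi_0}(u)|\,du$; let $\bar\gamma(s)$ be the reparametrization of $\gamma$ by $s$, so $|\bar\gamma'_{\xi_0}(s)|=1$.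 Put $X(s)=\bar\gamma'_{\xi_0}(s)$, $Y(s)=J_0X(s)$. The $p$-curvature and $T$-variation of $\gamma$ at parameter $t$ are $k=\langle\frac{dX}{ds},Y\rangle$ and $\tau=\langle\bar\gamma'(s),T\rangle$ evaluated at $s=s(t)$. Here $\frac{dX}{ds}$ is the componentwise derivative of $X$ viewed as an $\mathbb{R}^3$-valued function (components with respect to $\partial_x,\partial_y,\partial_z$), regarded as a tangent vector at $\bar\gamma(s)$. *)

(* Defs.v *)
From Stdlib Require Import Reals Lra ClassicalEpsilon.
From Coquelicot Require Import Coquelicot.

Open Scope R_scope.

(** Points of [H1], and tangent vectors written in the coordinate frame
    [(d/dx, d/dy, d/dz)], are both triples. *)
Definition R3 : Type := (R * R * R)%type.
Definition px (p : R3) : R := fst (fst p).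
Definition py (p : R3) : R := snd (fst p).
Definition pz (p : R3) : R := snd p.

Definition H1_mul (p q : R3) : R3 :=
  (px p + px q, py p + py q, pz p + pz q + py p * px q - px p * py q).

Definition e1 (p : R3) : R3 := (1, 0, py p).
Definition e2 (p : R3) : R3 := (0, 1, - px p).
Definition T (p : R3) : R3 := (0, 0, 1).

Definition vadd (v w : R3) : R3 := (px v + px w, py v + py w, pz v + pz w).
Definition vscal (a : R) (v : R3) : R3 := (a * px v, a * py v, a * pz v).

(** The coefficients of [v], based at [p], in the frame [e1 p, e2 p, T p];
    see [frame_decomposition]. *)
Definition coef1 (p v : R3) : R := px v.
Definition coef2 (p v : R3) : R := py v.
Definition coefT (p v : R3) : R := pz v - py p * px v + px p * py v.

Definition contact_part (p v : R3) : R3 :=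
  vadd (vscal (coef1 p v) (e1 p)) (vscal (coef2 p v) (e2 p)).
Definition T_part (p v : R3) : R3 := vscal (coefT p v) (T p).

(** Only meaningful for [v] in the contact plane at [p]; elsewhere it ignores
    the [T] component. *)
Definition J0 (p v : R3) : R3 :=
  vadd (vscal (coef1 p v) (e2 p)) (vscal (- coef2 p v) (e1 p)).

(** Characterized by [frame_orthonormal] among bilinear forms. *)
Definition inner (p v w : R3) : R :=
  coef1 p v * coef1 p w + coef2 p v * coef2 p w + coefT p v * coefT p w.
Definition vnorm (p v : R3) : R := sqrt (inner p v v).

(** Componentwise derivative, for curves as well as for vector fields along
    them. *)
Definition deriv3 (f : R -> R3) (t : R) : R3 :=
  (Derive (fun u => px (f u)) t,
   Derive (fun u => py (f u)) t,
   Derive (fun u => pz (f u)) t).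

Definition Rbar_open_interval (a b : Rbar) (t : R) : Prop :=
  Rbar_lt a t /\ Rbar_lt t b.

Definition smooth_on (I : R -> Prop) (f : R -> R3) : Prop :=
  forall (n : nat) (t : R), I t ->
    ex_derive_n (fun u => px (f u)) n t /\
    ex_derive_n (fun u => py (f u)) n t /\
    ex_derive_n (fun u => pz (f u)) n t.

Definition contact_velocity (g : R -> R3) (t : R) : R3 :=
  contact_part (g t) (deriv3 g t).

Definition horizontally_regular (I : R -> Prop) (g : R -> R3) : Prop :=
  forall t : R, I t -> contact_velocity g t <> (0, 0, 0).

Definition arc_length (g : R -> R3) (t0 t : R) : R :=
  RInt (fun u => vnorm (g u) (contact_velocity g u)) t0 t.

(** The parameter in [I] whose horizontal arc-length from [t0] is [s]
    (arbitrary when [s] is not in the image of [I]). *)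
Definition arc_length_inv (I : R -> Prop) (g : R -> R3) (t0 s : R) : R :=
  epsilon (inhabits t0) (fun t => I t /\ arc_length g t0 t = s).

Definition reparam (I : R -> Prop) (g : R -> R3) (t0 s : R) : R3 :=
  g (arc_length_inv I g t0 s).

Definition frame_X (I : R -> Prop) (g : R -> R3) (t0 s : R) : R3 :=
  contact_velocity (reparam I g t0) s.

Definition frame_Y (I : R -> Prop) (g : R -> R3) (t0 s : R) : R3 :=
  J0 (reparam I g t0 s) (frame_X I g t0 s).

Definition p_curvature (I : R -> Prop) (g : R -> R3) (t0 t : R) : R :=
  let s := arc_length g t0 t in
  inner (reparam I g t0 s) (deriv3 (frame_X I g t0) s) (frame_Y I g t0 s).

Definition T_variation (I : R -> Prop) (g : R -> R3) (t0 t : R) : R :=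
  let s := arc_length g t0 t in
  inner (reparam I g t0 s) (deriv3 (reparam I g t0) s) (T (reparam I g t0 s)).

Local Ltac unf :=
  unfold H1_mul, contact_part, T_part, J0, inner, vadd, vscal, coef1, coef2,
    coefT, e1, e2, T, px, py, pz; simpl.

Lemma frame_left_invariant (p : R3) (t : R) :
  H1_mul p (t, 0, 0) = vadd p (vscal t (e1 p)) /\
  H1_mul p (0, t, 0) = vadd p (vscal t (e2 p)) /\
  H1_mul p (0, 0, t) = vadd p (vscal t (T p)).
Proof.
unf; repeat split; repeat apply f_equal2; ring.
Qed.

Lemma frame_decomposition (p v : R3) :
  v = vadd (contact_part p v) (T_part p v).
Proof.
destruct v as [[a b] c]; unf; repeat apply f_equal2; ring.
Qed.

Lemma frame_orthonormal (p : R3) :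
  inner p (e1 p) (e1 p) = 1 /\ inner p (e2 p) (e2 p) = 1 /\
  inner p (T p) (T p) = 1 /\ inner p (e1 p) (e2 p) = 0 /\
  inner p (e1 p) (T p) = 0 /\ inner p (e2 p) (T p) = 0.
Proof.
unf; repeat split; ring.
Qed.

Lemma J0_frame (p : R3) :
  J0 p (e1 p) = e2 p /\ J0 p (e2 p) = vscal (- 1) (e1 p).
Proof.
unf; split; repeat apply f_equal2; ring.
Qed.

(* Main.v *)
(** Let [v = sqrt (x'^2 + y'^2)] be the horizontal speed.  The arc-length has
    derivative [v > 0], so its inverse [psi] is differentiable with derivative
    [1 / v], and in the arc-length parameter the planar part of [X] is
    [(x' / v, y' / v)] composed with [psi].  In
    [<dX/ds, Y> = X1 X2' - X2 X1'] the terms containing [v'] cancel, which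
    leaves [(x' y'' - x'' y') / v^3]. *)
Require Import Defs.
From Stdlib Require Import Reals Lra Ranalysis5 ClassicalEpsilon.
From Coquelicot Require Import Coquelicot.

Open Scope R_scope.

(** * Inverting an increasing function on an open interval *)

Lemma open_Rbar_open_interval (a b : Rbar) : open (Rbar_open_interval a b).
Proof.
apply open_and; [apply open_Rbar_gt | apply open_Rbar_lt].
Qed.

Lemma Rbar_open_interval_between (a b : Rbar) (t1 t2 u : R) :
  Rbar_open_interval a b t1 -> Rbar_open_interval a b t2 ->
  t1 <= u <= t2 -> Rbar_open_interval a b u.
Proof.
intros [H1 _] [_ H2] [Hu1 Hu2]; split.
- now apply Rbar_lt_le_trans with t1.
- now apply Rbar_le_lt_trans with t2.
Qed.

(** Here [g] is constrained only on the image of [I]. The intermediate value theorem shows that this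
    image contains a neighbourhood of [f t], so [g] is there a true inverse. The local conjunct lets
    identities along [f] be differentiated in the variable [s]. *)
Lemma is_derive_increasing_inverse (a b : Rbar) (f df g : R -> R) :
  let I := Rbar_open_interval a b in
  (forall u, I u -> is_derive f u (df u)) ->
  (forall u, I u -> 0 < df u) ->
  (forall u, I u -> g (f u) = u) ->
  forall t, I t ->
  locally (f t) (fun s => I (g s) /\ f (g s) = s) /\
  is_derive g (f t) (/ df t).
Proof.
intros I Hf Hpos Hgf t Ht.
destruct (open_Rbar_open_interval a b t Ht) as [d Hd].
(* Half the radius keeps a closed interval around [t], endpoints included, inside [I]. *)
assert (Hball : forall u, t - d / 2 <= u <= t + d / 2 -> I u).
{ intros u Hu; apply Hd.
  change (Rabs (u - t) < d).
  pose proof (cond_pos d); apply Rabs_def1; lra. }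
set (t1 := t - d / 2) in *; set (t2 := t + d / 2) in *.
assert (Ht12 : t1 < t < t2) by (pose proof (cond_pos d); unfold t1, t2; lra).
assert (Hincr : forall u w, I u -> I w -> u < w -> f u < f w).
{ intros u w [Hu _] [_ Hw] Huw.
  apply (incr_function f a b df); trivial.
  - intros r Hr1 Hr2; apply Hf; now split.
  - intros r Hr1 Hr2; apply Hpos; now split. }
assert (Hder : forall u, t1 <= u <= t2 -> derivable_pt f u).
{ intros u Hu; exists (df u); apply is_derive_Reals, Hf, Hball, Hu. }
assert (Hcont : forall u, t1 <= u <= t2 -> continuity_pt f u).
{ intros u Hu; now apply derivable_continuous_pt, Hder. }
assert (Hinv : forall s, f t1 <= s <= f t2 -> t1 <= g s <= t2 /\ f (g s) = s).
{ intros s Hs.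
  destruct (f_interv_is_interv f t1 t2 s) as [u [Hu <-]]; trivial; try lra.
  rewrite Hgf by now apply Hball.
  now split. }
assert (Hft : f t1 < f t < f t2).
{ split; apply Hincr; try apply Hball; lra. }
split.
- apply (locally_interval _ (f t) (f t1) (f t2)); try apply Hft.
  simpl; intros s H1 H2.
  destruct (Hinv s) as [Hs Hfs]; [lra |].
  split; [now apply Hball | exact Hfs].
- assert (Hgt : g (f t) = t) by now apply Hgf.
  assert (Hgc : continuity_pt g (f t)).
  { apply (continuity_pt_recip_interv f g t1 t2); trivial; try lra.
    - intros u w Hu Huw Hw; apply Hincr; try apply Hball; lra.
    - intros s H1 H2; now apply Hinv.
    - intros s H1 H2; now apply Hinv. }
  assert (Hg1 : g (f t1) = t1) by (apply Hgf, Hball; lra).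
  assert (Hg2 : g (f t2) = t2) by (apply Hgf, Hball; lra).
  (* The inverse rule takes derivability proofs over the interval from [g (f t1)] to [g (f t2)],
     which is the interval from [t1] to [t2]. *)
  assert (Prf : forall u, g (f t1) <= u <= g (f t2) -> derivable_pt f u).
  { rewrite Hg1, Hg2; exact Hder. }
  assert (Hgtb : g (f t1) <= g (f t) <= g (f t2)).
  { rewrite Hg1, Hg2, Hgt; lra. }
  assert (Hd' : derive_pt f (g (f t)) (Prf (g (f t)) Hgtb) = df t).
  { apply derive_pt_eq_0; rewrite Hgt; now apply is_derive_Reals, Hf. }
  apply is_derive_Reals.
  replace (/ df t) with
    (1 / derive_pt f (g (f t)) (Prf (g (f t)) Hgtb)).
  + apply (derivable_pt_lim_recip_interv f g (f t1) (f t2)); trivial; try lra.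
    * intros s Hs; now apply Hinv.
    * rewrite Hd'; apply Rgt_not_eq, Hpos, Ht.
  + rewrite Hd'; unfold Rdiv; ring.
Qed.

(** * Horizontal speed in coordinates *)

Definition speed (g : R -> R3) (t : R) : R :=
  vnorm (g t) (contact_velocity g t).

Lemma contact_velocity_coordinates (g : R -> R3) (t : R) :
  let x := fun u => px (g u) in
  let y := fun u => py (g u) in
  contact_velocity g t =
    (Derive x t, Derive y t, y t * Derive x t - x t * Derive y t).
Proof.
unfold contact_velocity, contact_part, vadd, vscal, coef1, coef2, e1, e2,
  deriv3, px, py, pz; simpl.
repeat apply f_equal2; ring.
Qed.

Lemma speed_coordinates (g : R -> R3) (t : R) :
  speed g t =
    sqrt (Derive (fun u => px (g u)) t ^ 2 + Derive (fun u => py (g u)) t ^ 2).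
Proof.
unfold speed, vnorm; rewrite contact_velocity_coordinates.
unfold inner, coef1, coef2, coefT, px, py, pz; simpl.
f_equal; ring.
Qed.

(** * Arc-length of a regular curve and its inverse *)

Section Curve.

Variables (a b : Rbar) (g : R -> R3) (t0 : R).
Let I := Rbar_open_interval a b.
Let x := fun u => px (g u).
Let y := fun u => py (g u).
Let z := fun u => pz (g u).
Hypothesis Hsmooth : smooth_on I g.
Hypothesis Hreg : horizontally_regular I g.
Hypothesis Ht0 : I t0.

(** The last coordinate [y x' - x y'] of the contact velocity vanishes with [x'] and [y'], so
    regularity forbids both being zero. *)
Lemma horizontal_speed_sqr_pos (t : R) :
  I t -> 0 < Derive x t ^ 2 + Derive y t ^ 2.
Proof.
intros Ht.
destruct (Req_dec (Derive x t) 0) as [Hx | Hx];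
  [destruct (Req_dec (Derive y t) 0) as [Hy | Hy] |]; try nra.
exfalso; apply (Hreg t Ht).
rewrite contact_velocity_coordinates; fold x y.
rewrite Hx, Hy; repeat apply f_equal2; ring.
Qed.

Lemma speed_pos (t : R) : I t -> 0 < speed g t.
Proof.
intros Ht; rewrite speed_coordinates.
now apply sqrt_lt_R0, horizontal_speed_sqr_pos.
Qed.

Lemma is_derive_coordinates (t : R) : I t ->
  is_derive x t (Derive x t) /\ is_derive y t (Derive y t) /\
  is_derive z t (Derive z t).
Proof.
intros Ht; destruct (Hsmooth 1%nat t Ht) as (Hx & Hy & Hz).
now repeat split; apply Derive_correct.
Qed.

Lemma is_derive_Derive_coordinates (t : R) : I t ->
  is_derive (Derive x) t (Derive_n x 2 t) /\
  is_derive (Derive y) t (Derive_n y 2 t).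
Proof.
intros Ht; destruct (Hsmooth 2%nat t Ht) as (Hx & Hy & _).
split; [exact (Derive_correct _ _ Hx) | exact (Derive_correct _ _ Hy)].
Qed.

(** The square root is differentiable away from zero. The value [l] stays unnamed because it cancels
    in the curvature. *)
Lemma is_derive_speed (t : R) : I t -> exists l : R, is_derive (speed g) t l.
Proof.
intros Ht; destruct (is_derive_Derive_coordinates t Ht) as [Hx Hy].
pose proof (horizontal_speed_sqr_pos t Ht) as Hpos.
eexists.
apply (is_derive_ext (fun u => sqrt (Derive x u ^ 2 + Derive y u ^ 2))).
- intros u; symmetry; apply speed_coordinates.
- apply is_derive_sqrt; [| exact Hpos].
  apply (is_derive_plus (V := R_NormedModule));
    apply (is_derive_pow _ 2%nat); eassumption.
Qed.

Lemma is_derive_arc_length (t : R) :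
  I t -> is_derive (arc_length g t0) t (speed g t).
Proof.
assert (Hcont : forall u, I u -> continuous (speed g) u).
{ intros u Hu; destruct (is_derive_speed u Hu) as [l Hl].
  apply (ex_derive_continuous (V := R_NormedModule)); now exists l. }
intros Ht.
apply (is_derive_RInt (speed g) (arc_length g t0) t0); [| now apply Hcont].
(* The fundamental theorem asks for integrability up to every [u] near [t]; the segment between [t0]
   and [u] lies in [I], where the speed is continuous. *)
apply filter_imp with (2 := open_Rbar_open_interval a b t Ht).
intros u Hu.
apply (RInt_correct (speed g)), (ex_RInt_continuous (V := R_CompleteNormedModule)).
intros w Hw; apply Hcont.
destruct (Rle_dec t0 u) as [Hle | Hle].
- rewrite Rmin_left, Rmax_right in Hw by lra.
  now apply Rbar_open_interval_between with t0 u.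
- rewrite Rmin_right, Rmax_left in Hw by lra.
  now apply Rbar_open_interval_between with u t0.
Qed.

Lemma arc_length_inj (u w : R) :
  I u -> I w -> arc_length g t0 u = arc_length g t0 w -> u = w.
Proof.
assert (Hincr : forall r s, I r -> I s -> r < s ->
                arc_length g t0 r < arc_length g t0 s).
{ intros r s [Hr _] [_ Hs] Hrs.
  apply (incr_function _ a b (speed g)); trivial.
  - intros q Hq1 Hq2; apply is_derive_arc_length; now split.
  - intros q Hq1 Hq2; apply speed_pos; now split. }
intros Hu Hw Heq.
destruct (Rtotal_order u w) as [H | [H | H]]; trivial.
- pose proof (Hincr u w Hu Hw H); lra.
- pose proof (Hincr w u Hw Hu H); lra.
Qed.

(** The parameter [t] witnesses the choice, and injectivity leaves no other. *)
Lemma arc_length_invK (t : R) :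
  I t -> arc_length_inv I g t0 (arc_length g t0 t) = t.
Proof.
intros Ht; unfold arc_length_inv.
destruct (epsilon_spec (inhabits t0)
  (fun u => I u /\ arc_length g t0 u = arc_length g t0 t)) as [H1 H2].
- now exists t.
- now apply arc_length_inj.
Qed.

(** Chain rule: d/ds is d/dt divided by the speed. *)
Lemma is_derive_comp_arc_length_inv (f : R -> R) (t l : R) :
  I t -> is_derive f t l ->
  is_derive (fun s => f (arc_length_inv I g t0 s)) (arc_length g t0 t)
    (l / speed g t).
Proof.
intros Ht Hf.
destruct (is_derive_increasing_inverse a b (arc_length g t0) (speed g)
  (arc_length_inv I g t0) is_derive_arc_length speed_pos arc_length_invK t Ht)
  as [_ Hpsi].
replace (l / speed g t) with (scal (/ speed g t) l)
  by (unfold scal; simpl; unfold mult; simpl; field;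
      apply Rgt_not_eq, speed_pos, Ht).
apply (is_derive_comp f (arc_length_inv I g t0)); [| exact Hpsi].
now rewrite arc_length_invK.
Qed.

(** * The arc-length frame and the two invariants *)

Lemma deriv3_reparam (t : R) : I t ->
  deriv3 (reparam I g t0) (arc_length g t0 t) =
  (Derive x t / speed g t, Derive y t / speed g t, Derive z t / speed g t).
Proof.
intros Ht; destruct (is_derive_coordinates t Ht) as (Hx & Hy & Hz).
unfold deriv3, reparam.
repeat apply f_equal2; apply is_derive_unique;
  now apply (is_derive_comp_arc_length_inv (fun u => _ (g u))).
Qed.

(** Differentiating [X] requires its formula on a neighbourhood, where every [s] is the arc-length
    of some [u] in [I]. *)
Lemma frame_X_near (t : R) : I t ->
  locally (arc_length g t0 t) (fun s =>
    let u := arc_length_inv I g t0 s in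
    px (frame_X I g t0 s) = Derive x u / speed g u /\
    py (frame_X I g t0 s) = Derive y u / speed g u).
Proof.
intros Ht.
destruct (is_derive_increasing_inverse a b (arc_length g t0) (speed g)
  (arc_length_inv I g t0) is_derive_arc_length speed_pos arc_length_invK t Ht)
  as [Hloc _].
apply filter_imp with (2 := Hloc); intros s [Hu Hs] u.
fold u in Hu, Hs.
pose proof (deriv3_reparam u Hu) as Hd; rewrite Hs in Hd.
injection Hd as Hx Hy _.
unfold frame_X; rewrite contact_velocity_coordinates.
now split.
Qed.

Lemma p_curvature_speed (t : R) : I t ->
  p_curvature I g t0 t =
    (Derive x t * Derive_n y 2 t - Derive_n x 2 t * Derive y t) /
      speed g t ^ 3.
Proof.
intros Ht.
destruct (is_derive_speed t Ht) as [v' Hv].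
destruct (is_derive_Derive_coordinates t Ht) as [Hx Hy].
pose proof (speed_pos t Ht) as Hpos.
pose proof (frame_X_near t Ht) as HX.
assert (H0 := locally_singleton _ _ HX); simpl in H0.
rewrite arc_length_invK in H0 by exact Ht.
destruct H0 as [HX0 HY0].
(* Quotient rule for [x' / v], then one more division by [v] from passing to [s]. *)
assert (HdX : Derive (fun s => px (frame_X I g t0 s)) (arc_length g t0 t) =
  (Derive_n x 2 t * speed g t - Derive x t * v') / speed g t ^ 2 / speed g t).
{ rewrite (Derive_ext_loc _
    (fun s => Derive x (arc_length_inv I g t0 s)
                / speed g (arc_length_inv I g t0 s))).
  - apply is_derive_unique.
    apply (is_derive_comp_arc_length_inv (fun u => Derive x u / speed g u));
      trivial.
    apply is_derive_div; trivial; lra.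
  - apply filter_imp with (2 := HX); now intros s []. }
assert (HdY : Derive (fun s => py (frame_X I g t0 s)) (arc_length g t0 t) =
  (Derive_n y 2 t * speed g t - Derive y t * v') / speed g t ^ 2 / speed g t).
{ rewrite (Derive_ext_loc _
    (fun s => Derive y (arc_length_inv I g t0 s)
                / speed g (arc_length_inv I g t0 s))).
  - apply is_derive_unique.
    apply (is_derive_comp_arc_length_inv (fun u => Derive y u / speed g u));
      trivial.
    apply is_derive_div; trivial; lra.
  - apply filter_imp with (2 := HX); now intros s []. }
(* [J0 p w] is always horizontal, so the [T] component of dX/ds drops out and a planar determinant
   remains. *)
assert (Hinner : forall p v w : R3,
  inner p v (J0 p w) = px w * py v - py w * px v).
{ intros p v w.
  unfold inner, J0, vadd, vscal, coef1, coef2, coefT, e1, e2, px, py, pz; simpl.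
  ring. }
unfold p_curvature, frame_Y; rewrite Hinner, HX0, HY0.
change (px (deriv3 ?f ?s)) with (Derive (fun u => px (f u)) s).
change (py (deriv3 ?f ?s)) with (Derive (fun u => py (f u)) s).
rewrite HdX, HdY.
field; lra.
Qed.

(** Pairing with [T] extracts [coefT], which is linear in the velocity, so the factor [1 / v] comes
    out. *)
Lemma T_variation_speed (t : R) : I t ->
  T_variation I g t0 t =
    (x t * Derive y t - Derive x t * y t + Derive z t) / speed g t.
Proof.
intros Ht; pose proof (speed_pos t Ht) as Hpos.
unfold T_variation; rewrite deriv3_reparam by exact Ht.
unfold reparam; rewrite arc_length_invK by exact Ht.
unfold inner, coef1, coef2, coefT, T, x, y, px, py, pz; simpl.
field; lra.
Qed.

End Curve.

(** * Real exponents and the final formulas *)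

Lemma Rpower_half (r : R) : 0 < r -> Rpower r (1 / 2) = sqrt r.
Proof.
intros Hr; rewrite <- Rpower_sqrt by exact Hr; f_equal; lra.
Qed.

Lemma Rpower_three_halves (r : R) : 0 < r -> Rpower r (3 / 2) = sqrt r ^ 3.
Proof.
intros Hr.
replace (3 / 2) with (1 / 2 + (1 / 2 + 1 / 2)) by lra.
rewrite !Rpower_plus, Rpower_half by exact Hr; ring.
Qed.

Theorem theorem1p4 :
  forall (a b : Rbar) (x y z : R -> R),
  let I := Rbar_open_interval a b in
  let gamma := fun t : R => (x t, y t, z t) : R3 in
  smooth_on I gamma ->
  horizontally_regular I gamma ->
  forall t0 t : R, I t0 -> I t ->
  p_curvature I gamma t0 t =
    (Derive x t * Derive_n y 2 t - Derive_n x 2 t * Derive y t) /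
      Rpower ((Derive x t) ^ 2 + (Derive y t) ^ 2) (3 / 2) /\
  T_variation I gamma t0 t =
    (x t * Derive y t - Derive x t * y t + Derive z t) /
      Rpower ((Derive x t) ^ 2 + (Derive y t) ^ 2) (1 / 2).
Proof.
intros a b x y z I gamma Hsmooth Hreg t0 t Ht0 Ht.
(* [px (gamma u)] and [py (gamma u)] compute to [x u] and [y u], so the coordinate lemmas apply by
   conversion. *)
assert (Hpos : 0 < Derive x t ^ 2 + Derive y t ^ 2)
  by exact (horizontal_speed_sqr_pos a b gamma Hreg t Ht).
assert (Hv : speed gamma t = sqrt (Derive x t ^ 2 + Derive y t ^ 2))
  by exact (speed_coordinates gamma t).
rewrite Rpower_half, Rpower_three_halves, <- Hv by exact Hpos.
split.
- now apply p_curvature_speed.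
- now apply T_variation_speed.
Qed.
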